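(* Let $b\in\mathbb{R}^p$ and let $C\subset\mathbb{R}^p$ be a closed convex set such that $0\in C$ and $0<\Upsilon(b\mid C)<+\infty$. Define $\psi(\lambda):=\|\lambda\Pi_{C}(\lambda^{-1}b)\|=\|\Pi_{\lambda C}(b)\|$ for $\lambda>0$. Then for any $\bar\lambda\in(0,\Upsilon(b\mid C))$, the Clarke generalized Jacobian of $\psi$ at $\bar\lambda$ satisfies $\partial\psi(\bar\lambda)\subset\mathbb{R}_{++}$, i.e., every element of $\partial\psi(\bar\lambda)$ is a positive real number.
   Context: $\|\cdot\|$ is the Euclidean norm on $\mathbb{R}^p$ and $\Pi_S$ is the Euclidean projection onto a nonempty closed convex set $S$. The gauge function of a convex set $C$ is $\Upsilon(x\mid C):=\inf\{\lambda\geqslant 0\mid x\in\lambda C\}$. $\mathbb{R}_{++}$ is the set of positive real numbers. For a locally Lipschitz continuous function $F$ on an open set, with $D_F$ the set of its differentiability points, the B-subdifferential at $x$ is $\partial_B F(x):=\{V\mid \exists \{x^k\}\subseteq D_F,\ x^k\to x,\ F'(x^k)\to V\}$, and the Clarke generalized Jacobian is $\partial F(x):=\operatorname{conv}(\partial_B F(x))$. (The function $\psi$ is locally Lipschitz on $(0,+\infty)$.) *)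

(* Defs.v *)
From HB Require Import structures.
From mathcomp Require Import all_boot all_order all_algebra.
From mathcomp Require Import all_classical all_reals all_analysis.
From mathcomp Require Import ring lra.

Set Implicit Arguments.
Unset Strict Implicit.
Unset Printing Implicit Defensive.

Import Order.TTheory GRing.Theory Num.Theory.
Import numFieldNormedType.Exports.

Local Open Scope classical_set_scope.
Local Open Scope ring_scope.

(* The library's norm [`|x|] on ['rV[R]_p] is the sup norm. It induces the same
   topology as [enorm], so the library's [closed] is the usual notion. *)
Definition enorm (R : realType) (p : nat) (x : 'rV[R]_p) : R :=
  Num.sqrt (\sum_(i < p) x 0 i ^+ 2).

Definition scale_set (R : realType) (p : nat) (l : R) (C : set 'rV[R]_p) :
  set 'rV[R]_p := [set l *: c | c in C].

(* Extended-real valued: the infimum of the empty set is +oo. *)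
Definition gauge (R : realType) (p : nat) (C : set 'rV[R]_p) (x : 'rV[R]_p) :
  \bar R := ereal_inf [set l%:E | l in [set l : R | 0 <= l /\ scale_set l C x]].

Definition nearest (R : realType) (p : nat) (S : set 'rV[R]_p) (x : 'rV[R]_p) :
  set 'rV[R]_p :=
  [set z | S z /\ forall y, S y -> enorm (x - z) <= enorm (x - y)].

(* [nearest S x] is a singleton when S is nonempty, closed and convex; the
   default value 0 is used only when it is empty. *)
Definition proj (R : realType) (p : nat) (S : set 'rV[R]_p) (x : 'rV[R]_p) :
  'rV[R]_p := xget 0 (nearest S x).

Definition psi (R : realType) (p : nat) (C : set 'rV[R]_p) (b : 'rV[R]_p)
  (l : R) : R := enorm (l *: proj C (l^-1 *: b)).

(* B-subdifferential of a real function F considered on the open set U; the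
   values of the total function F outside U are irrelevant. *)
Definition Bsubdiff (R : realType) (U : set R) (F : R -> R) (x : R) : set R :=
  [set v | exists2 u : nat -> R,
     (forall k, U (u k) /\ derivable F (u k) 1) &
     u @ \oo --> x /\ derive1 F (u k) @[k --> \oo] --> v].

Definition conv_hull (R : realType) (A : set R) : set R :=
  smallest (@convex_set R R^o) A.

Definition clarke (R : realType) (U : set R) (F : R -> R) (x : R) : set R :=
  conv_hull (Bsubdiff U F x).

Section psi_two_forms.
Variables (R : realType) (p : nat).
Implicit Types (S C : set 'rV[R]_p) (x y z b : 'rV[R]_p) (l : R).

Let sqn x : R := \sum_(i < p) x 0 i ^+ 2.

Let sqn_ge0 x : 0 <= sqn x.
Proof. by apply: sumr_ge0 => i _; exact: sqr_ge0. Qed.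

Let ler_enorm x y : (enorm x <= enorm y) = (sqn x <= sqn y).
Proof. by rewrite /enorm ler_sqrt // sqn_ge0. Qed.

Lemma enormZ l x : enorm (l *: x) = `|l| * enorm x.
Proof.
rewrite /enorm -sqrtr_sqr -sqrtrM ?sqr_ge0// mulr_sumr.
by congr Num.sqrt; apply: eq_bigr => i _; rewrite mxE exprMn.
Qed.

Lemma nearest_unique S x z w :
  convex_set (S : set (convex_lmodType 'rV[R]_p)) ->
  nearest S x z -> nearest S x w -> z = w.
Proof.
move=> cS [Sz hz] [Sw hw].
have h0 : 0 <= (2^-1 : R) by lra.
have h1 : (2^-1 : R) <= 1 by lra.
have Sm : S (2^-1 *: z + 2^-1 *: w).
  have := @cS z w (Itv01 h0 h1).
  rewrite !inE => /(_ Sz Sw); congr S.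
  rewrite /conv /=; congr (_ *: _ + _ *: _); rewrite /unstable.onem; lra.
have := hz _ Sm; have := hw _ Sm; rewrite !ler_enorm => hwm hzm.
have E : sqn (x - (2^-1 *: z + 2^-1 *: w)) =
    2^-1 * sqn (x - z) + 2^-1 * sqn (x - w) - 4^-1 * sqn (z - w).
  rewrite /sqn !mulr_sumr -big_split/= -sumrB; apply: eq_bigr => i _.
  by rewrite !mxE; field.
have : sqn (z - w) == 0 by rewrite eq_le sqn_ge0 andbT; lra.
rewrite psumr_eq0; last by move=> i _; exact: sqr_ge0.
move=> /allP h; apply/rowP => i; apply/eqP; rewrite -subr_eq0 -sqrf_eq0.
by have := h i (mem_index_enum i); rewrite !mxE.
Qed.

Lemma psi_proj_scale C b l :
  convex_set (C : set (convex_lmodType 'rV[R]_p)) -> 0 < l ->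
  psi C b l = enorm (proj (scale_set l C) b).
Proof.
move=> cC l0; have ln : l != 0 by rewrite gt_eqF.
congr enorm; rewrite /proj.
have eqd (c : 'rV[R]_p) : enorm (b - l *: c) = l * enorm (l^-1 *: b - c).
  have := enormZ l (l^-1 *: b - c); rewrite (gtr0_norm l0) => <-.
  by rewrite scalerBr scalerA mulfV// scale1r.
have nE c : nearest (scale_set l C) b (l *: c) <-> nearest C (l^-1 *: b) c.
  split=> -[Cc h]; split.
  - by case: Cc => d Cd /(scalerI ln) <-.
  - move=> y Cy; have := h (l *: y); rewrite !eqd ler_pM2l//.
    by apply; exists y.
  - by exists c.
  - by move=> _ [y Cy <-]; rewrite !eqd ler_pM2l//; exact: h.
have [[z hz]|h] := pselect (exists z, nearest C (l^-1 *: b) z).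
  rewrite (xget_unique _ hz); last first.
    by move=> y hy; apply: nearest_unique cC hy hz.
  rewrite (@xget_unique _ _ _ (l *: z))//; first exact/nE.
  move=> y hy; have [d Cd ye] := hy.1; rewrite -ye in hy *.
  by congr (_ *: _); apply: (nearest_unique cC) hz; exact/nE.
rewrite !xgetPN ?scaler0//.
  by move=> y hy; have [d Cd ye] := hy.1; rewrite -ye in hy; apply: h; exists d; exact/nE.
by move=> y hy; apply: h; exists y.
Qed.

End psi_two_forms.

(* Main.v *)
(* Let [r] be the residual of the projection [z] of [b] onto [lC], and
   [q = sup_C <r, .> / |r|], which is minus the slope of the convex function
   [l |-> dist(b, lC)]. Hence [|r|] and [q] are nonincreasing, and expanding
   [|b|^2 = |r + z|^2] shows that [|z|^2] grows between [l < m] by at least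
   [2 l q(m)^2 (m - l)]. If [b] lies in [tC] but not in [mC] then
   [q(m) >= |r| / (t - m) > 0], so that [psi] increases at a rate bounded away
   from 0 near [lbar]; this bound passes to derivatives, their limits, and
   convex combinations of these. *)
Require Import Defs.
From HB Require Import structures.
From mathcomp Require Import all_boot all_order all_algebra.
From mathcomp Require Import all_classical all_reals all_analysis.
From mathcomp Require Import ring lra.

Set Implicit Arguments.
Unset Strict Implicit.
Unset Printing Implicit Defensive.

Import Order.TTheory GRing.Theory Num.Theory.
Import numFieldNormedType.Exports.

Local Open Scope classical_set_scope.
Local Open Scope ring_scope.

(** * Euclidean inner product and norm *)

Section dot_product.
Context {R : realType} {p : nat}.
Implicit Types (x y z : 'rV[R]_p) (l : R).

Definition dot x y : R := \sum_(i < p) x 0 i * y 0 i.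

Lemma dotC x y : dot x y = dot y x.
Proof. by apply: eq_bigr => i _; rewrite mulrC. Qed.

Lemma dotDr x y z : dot x (y + z) = dot x y + dot x z.
Proof. by rewrite -big_split; apply: eq_bigr => i _; rewrite mxE mulrDr. Qed.

Lemma dotZr l x y : dot x (l *: y) = l * dot x y.
Proof. by rewrite mulr_sumr; apply: eq_bigr => i _; rewrite mxE mulrCA. Qed.

Lemma dotNr x y : dot x (- y) = - dot x y.
Proof. by rewrite -scaleN1r dotZr mulN1r. Qed.

Lemma dotDl x y z : dot (x + y) z = dot x z + dot y z.
Proof. by rewrite dotC dotDr !(dotC z). Qed.

Lemma dotNl x y : dot (- x) y = - dot x y.
Proof. by rewrite dotC dotNr dotC. Qed.

Lemma dotZl l x y : dot (l *: x) y = l * dot x y.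
Proof. by rewrite dotC dotZr dotC. Qed.

Definition dotE := (dotDl, dotDr, dotNl, dotNr, dotZl, dotZr).

Lemma enorm_ge0 x : 0 <= enorm x.
Proof. exact: sqrtr_ge0. Qed.

Lemma dotxx x : dot x x = enorm x ^+ 2.
Proof.
rewrite /enorm sqr_sqrtr; last by apply: sumr_ge0 => i _; exact: sqr_ge0.
by apply: eq_bigr => i _; rewrite expr2.
Qed.

Lemma le_enorm x y : (enorm x <= enorm y) = (dot x x <= dot y y).
Proof. by rewrite !dotxx ler_pXn2r ?nnegrE ?enorm_ge0. Qed.

Lemma coord_le_enorm x i : `|x 0 i| <= enorm x.
Proof.
rewrite -sqrtr_sqr ler_sqrt; last by apply: sumr_ge0 => j _; exact: sqr_ge0.
by rewrite (bigD1 i)//= lerDl; apply: sumr_ge0 => j _; exact: sqr_ge0.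
Qed.

Lemma enorm_eq0 x : enorm x = 0 -> x = 0.
Proof.
move=> x0; apply/rowP => i; rewrite mxE; apply/eqP.
by rewrite -normr_le0 -x0 coord_le_enorm.
Qed.

(** Expand the squared norm of [enorm y *: x - enorm x *: y] and divide by [enorm x * enorm y]. *)
Lemma cauchy_schwarz x y : dot x y <= enorm x * enorm y.
Proof.
have [x0|x0] := eqVneq (enorm x) 0.
  by rewrite (enorm_eq0 x0) -(scale0r 0) dotZl mul0r mulr_ge0 ?enorm_ge0.
have [y0|y0] := eqVneq (enorm y) 0.
  by rewrite (enorm_eq0 y0) -(scale0r 0) dotZr mul0r mulr_ge0 ?enorm_ge0.
have := sqr_ge0 (enorm (enorm y *: x - enorm x *: y)).
rewrite -dotxx !dotE (dotC y x) !dotxx => h.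
have xy : 0 < enorm x * enorm y.
  by rewrite mulr_gt0// lt_neqAle eq_sym ?x0 ?y0 enorm_ge0.
by rewrite -(ler_pM2l xy); nra.
Qed.

Lemma continuous_enorm_sub x : continuous (fun y => enorm (x - y)).
Proof.
move=> y; apply: (@continuous_comp _ _ _
  (fun y => \sum_(i < p) (x - y) 0 i ^+ 2) Num.sqrt);
  last exact: sqrt_continuous.
move: y; apply: continuous_big => [|i _ {}y].
  exact: add_continuous.
rewrite (_ : (fun _ => _) = (fun z : 'rV_p => (x 0 i - z 0 i) ^+ 2)); last first.
  by apply/funext => z; rewrite !mxE.
apply: (@continuous_comp _ _ _ (fun z : 'rV_p => x 0 i - z 0 i) (fun a => a ^+ 2)).
  apply: (@continuousB R R _ (fun=> x 0 i) (fun z : 'rV_p => z 0 i)).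
    exact: cst_continuous.
  exact: coord_continuous.
exact: exprn_continuous.
Qed.

End dot_product.

(** * Existence and variational inequality of the projection *)

Section projection.
Context {R : realType} {p : nat}.
Variable C : set 'rV[R]_p.
Hypothesis C_closed : closed C.
Hypothesis C_convex : convex_set (C : set (convex_lmodType 'rV[R]_p)).

(** The distance is minimised over the compact set [B] intersected with [C]; the box [B] contains
    every point at distance at most [e] from [x]. *)
Lemma nearest_exists (x c : 'rV[R]_p) : C c -> exists z, nearest C x z.
Proof.
move=> Cc; pose e := enorm (x - c).
pose B := [set v : 'rV[R]_p | forall i, `[x 0 i - e, x 0 i + e]%classic (v 0 i)].
have cB : compact B.
  by apply: (@rV_compact _ _ (fun i => `[x 0 i - e, x 0 i + e]%classic)) => i;
    exact: segment_compact.
have BP v : B v <-> forall i, `|x 0 i - v 0 i| <= e.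
  by split=> h i; have := h i; rewrite /= in_itv/= ler_norml; lra.
have bB v : enorm (x - v) <= e -> B v.
  move=> h; apply/BP => i.
  by have := coord_le_enorm (x - v) i; rewrite !mxE => /le_trans; apply.
have [|||z] := @EVT_min_rV R p (fun y => enorm (x - y)) (B `&` C).
- by exists c; split=> //; apply: bB.
- by apply: compact_closedI.
- by apply: continuous_subspaceT; exact: continuous_enorm_sub.
rewrite inE => -[Bz Cz] hz; exists z; split=> // y Cy.
have [h|h] := leP (enorm (x - y)) e.
  by apply: hz; rewrite inE; split=> //; exact: bB.
(* A point of [C] farther than [e] from [x] already loses to [c]. *)
apply: le_trans (ltW h); apply: hz; rewrite inE; split=> //; exact: bB.
Qed.

(** Moving from [z] towards [c] by a fraction [t] changes the squared distance to [x] by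
    [t ^+ 2 * n - 2 * t * d], which would be negative for small [t] if [d] were positive. *)
Lemma nearest_obtuse (x z c : 'rV[R]_p) :
  nearest C x z -> C c -> dot (x - z) (c - z) <= 0.
Proof.
move=> [Cz hz] Cc; rewrite leNgt; apply/negP => h.
set d := dot _ _ in h; pose n := dot (c - z) (c - z).
have n0 : 0 <= n by rewrite /n dotxx sqr_ge0.
have main (t : R) : 0 < t -> t <= 1 -> 2 * d <= t * n.
  move=> t0 t1; have Cm : C (t *: c + (1 - t) *: z).
    have := @C_convex c z (Itv01 (ltW t0) t1).
    by rewrite !inE => /(_ Cc Cz); congr C.
  have := hz _ Cm; rewrite le_enorm.
  rewrite (_ : x - (t *: c + _) = (x - z) - t *: (c - z)); last first.
    by apply/rowP => i; rewrite !mxE; ring.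
  move: @d @n h n0 t0; move: (x - z) (c - z) => v w /= _ _ t0.
  rewrite !dotE (dotC w v) => k.
  by rewrite -(ler_pM2l t0); lra.
(* This [t] satisfies [t * n = d - t * d < 2 * d], against [main]. *)
pose t := d / (d + n).
have dn : 0 < d + n by lra.
have t0 : 0 < t by rewrite divr_gt0.
have t1 : t <= 1 by rewrite ler_pdivrMr//; lra.
have tE : t * (d + n) = d by rewrite mulfVK// gt_eqF.
by have := main t t0 t1; nra.
Qed.

Lemma nearest_proj (x c : 'rV[R]_p) : C c -> nearest C x (Defs.proj C x).
Proof. by case/(nearest_exists x) => z hz; rewrite /Defs.proj; exact: (xgetI 0 hz). Qed.

End projection.

(** * Growth of [psi] through the residual of the projection *)

Section residual.
Context {R : realType} {p : nat}.
Variables (C : set 'rV[R]_p) (b : 'rV[R]_p).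
Hypothesis C_closed : closed C.
Hypothesis C_convex : convex_set (C : set (convex_lmodType 'rV[R]_p)).
Hypothesis C0 : C 0.

Let u (l : R) := Defs.proj C (l^-1 *: b).
Let r (l : R) := b - l *: u l.
Let rho (l : R) := enorm (r l).

(* The support function of [C] at [r l]. *)
Let s (l : R) := dot (r l) (u l).

Let Cu (l : R) : C (u l).
Proof. by have [] := nearest_proj C_closed (l^-1 *: b) C0. Qed.

(** This is the obtuse angle inequality at [l^-1 *: b], whose residual is [l^-1 *: r l]. *)
Let support (l : R) c : 0 < l -> C c -> dot (r l) c <= s l.
Proof.
move=> l0 Cc.
have := nearest_obtuse C_convex (nearest_proj C_closed (l^-1 *: b) C0) Cc.
rewrite -/(u l) (_ : _ - u l = l^-1 *: r l); last first.
  by rewrite /r scalerBr scalerA mulVf ?scale1r// gt_eqF.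
by rewrite dotZl pmulr_rle0 ?invr_gt0// dotDr dotNr subr_le0.
Qed.

Let s_ge0 (l : R) : 0 < l -> 0 <= s l.
Proof. by move=> l0; have := support l0 C0; rewrite -(scale0r 0) dotZr mul0r. Qed.

Let bE (l : R) : b = r l + l *: u l.
Proof. by rewrite /r subrK. Qed.

Let dot_r_b (l : R) : dot (r l) b = rho l ^+ 2 + l * s l.
Proof. by rewrite {1}(bE l) dotDr dotZr dotxx. Qed.

Let psi_sqr (l : R) : psi C b l ^+ 2 = enorm b ^+ 2 - rho l ^+ 2 - 2 * l * s l.
Proof.
have : dot b b = rho l ^+ 2 + 2 * l * s l + psi C b l ^+ 2.
  rewrite {1 2}(bE l) /psi -/(u l) -[enorm (l *: _) ^+ 2]dotxx.
  rewrite -[rho l ^+ 2]dotxx /s; move: (r l) (u l) => v w.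
  by rewrite !dotE (dotC w v); ring.
by rewrite dotxx; move: (rho l) (s l) (psi C b l) => *; lra.
Qed.

(** Pair [r l] with [b = r m + m *: u m]. Divided by [rho l > 0], the inequality says that
    [- s l / rho l] is a subgradient of [rho] at [l]. *)
Let subgradient (l m : R) : 0 < l -> 0 < m ->
  rho l ^+ 2 - rho l * rho m <= (m - l) * s l.
Proof.
move=> l0 m0.
have := dot_r_b l; rewrite {1}(bE m) dotDr dotZr.
have := ler_wpM2l (ltW m0) (support l0 (Cu m)).
have : dot (r l) (r m) <= rho l * rho m by exact: cauchy_schwarz.
move: (dot (r l) (r m)) (dot (r l) (u m)) (rho l) (rho m) (s l) => *; lra.
Qed.

Let psi_le (l : R) : 0 < l -> psi C b l <= enorm b.
Proof.
move=> l0; rewrite -(@ler_pXn2r _ 2)// ?nnegrE ?enorm_ge0//.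
rewrite psi_sqr; have := s_ge0 l0; move: (rho l) (s l) (enorm b) => *; nra.
Qed.

(** Pair [r l] with [b = t *: c]. For [t > l] and [rho l > 0] this forces [s l > 0]. *)
Let residual_support (l t : R) : 0 < l -> 0 <= t -> scale_set t C b ->
  rho l ^+ 2 <= (t - l) * s l.
Proof.
move=> l0 t0 [c Cc cb]; have := dot_r_b l; rewrite -{1}cb dotZr.
have := ler_wpM2l t0 (support l0 Cc).
move: (dot (r l) c) (rho l) (s l) => *; lra.
Qed.

Let rho_gt0 (l : R) : 0 < l -> (l%:E < gauge C b)%E -> 0 < rho l.
Proof.
move=> l0 lg; rewrite lt_neqAle enorm_ge0 andbT eq_sym.
apply/eqP => /enorm_eq0/eqP; rewrite subr_eq0 => /eqP bl.
move: lg; rewrite ltNge => /negP; apply; apply: ereal_inf_lbound.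
by exists l => //; split; [exact: ltW|exists (u l)].
Qed.

(** The subgradient inequalities at [l] and at [m] enclose [rho l - rho m] between [m - l] times the
    two slopes. *)
Let slope_mono (l m : R) : 0 < l -> l < m -> 0 < rho l -> 0 < rho m ->
  s m / rho m <= s l / rho l /\
  s m / rho m * (m - l) <= rho l - rho m.
Proof.
move=> l0 lm rl rm; have m0 := lt_trans l0 lm.
have := subgradient l0 m0; have := subgradient m0 l0.
move: (rho l) (rho m) (s l) (s m) rl rm => d d' S S' d0 d0'.
set q := S / d; set q' := S' / d'.
have -> : S = q * d by rewrite mulfVK// gt_eqF.
have -> : S' = q' * d' by rewrite mulfVK// gt_eqF.
move: q q' => q q' h' h.
have k1 : d - d' <= (m - l) * q by rewrite -(ler_pM2l d0); lra.
have k2 : q' * (m - l) <= d - d' by rewrite -(ler_pM2l d0'); lra.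
split=> //; have ml : 0 < m - l by lra.
by rewrite -(ler_pM2l ml); lra.
Qed.

Let psi_sqr_growth (l m : R) : 0 < l -> l < m -> 0 < rho l -> 0 < rho m ->
  2 * l * (s m / rho m) ^+ 2 * (m - l) <= psi C b m ^+ 2 - psi C b l ^+ 2.
Proof.
move=> l0 lm rl rm; have [] := slope_mono l0 lm rl rm.
have := psi_sqr l; have := psi_sqr m; have := s_ge0 (lt_trans l0 lm).
move: (psi C b l) (psi C b m) (rho l) (rho m) (s l) (s m) (enorm b) rl rm.
move=> P P' d d' S S' B d0 d0' S0 -> ->.
have : 0 <= S' / d' by rewrite divr_ge0// ltW.
set q := S / d; set q' := S' / d'.
have -> : S = q * d by rewrite mulfVK// gt_eqF.
have -> : S' = q' * d' by rewrite mulfVK// gt_eqF.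
move: q q' => q q' q0 qq dr.
have ml : 0 < m - l by lra.
have qd : 0 <= q' * (m - l) by rewrite mulr_ge0// ltW.
(* The right side of the goal minus the left is exactly the sum of the quantities in [e1] and [e3]
   and twice those in [e2] and [e4]. *)
have e1 : 0 <= (d - d' - q' * (m - l)) * (d + d') by rewrite mulr_ge0//; lra.
have e2 : 0 <= l * ((q - q') * d) by rewrite !mulr_ge0//; lra.
have e3 : 0 <= q' * (m - l) * (d - d') by rewrite mulr_ge0//; lra.
have e4 : 0 <= l * q' * (d - d' - q' * (m - l)).
  by rewrite mulr_ge0 ?mulr_ge0//; lra.
lra.
Qed.

Lemma psi_growth (a M : R) : (gauge C b < +oo)%E -> 0 < a -> a < M ->
  (M%:E < gauge C b)%E ->
  exists2 c : R, 0 < c & forall l m, a <= l -> l < m -> m <= M ->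
    c * (m - l) <= psi C b m - psi C b l.
Proof.
move=> /ereal_inf_lt[_ [t [t0 bt] <-] _] a0 aM Mg.
have M0 := lt_trans a0 aM.
have rM := rho_gt0 M0 Mg.
have Mt : M < t.
  rewrite -lte_fin; apply: lt_le_trans Mg _.
  by apply: ereal_inf_lbound; exists t.
(* By monotonicity the slope at the right end [M] is the least one on [[a, M]]. *)
pose Q := s M / rho M.
have Q0 : 0 < Q.
  rewrite divr_gt0// -(@pmulr_rgt0 _ (t - M)) ?subr_gt0//.
  by apply: lt_le_trans (residual_support M0 t0 bt); rewrite exprn_gt0.
have b0 : 0 < enorm b.
  rewrite lt_neqAle enorm_ge0 andbT eq_sym; apply/eqP => /enorm_eq0 b0.
  have : (gauge C b <= 0%:E)%E.
    apply: ereal_inf_lbound; exists 0 => //; split=> //.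
    by exists 0; rewrite ?scaler0.
  by rewrite leNgt (lt_trans _ Mg)// lte_fin.
have aQ : 0 < a * Q ^+ 2 by rewrite mulr_gt0// exprn_gt0.
(* The square of [psi] grows at rate at least [2 * a * Q ^+ 2], and
   [psi C b l + psi C b m <= 2 * enorm b]. *)
exists (a * Q ^+ 2 / enorm b); first exact: divr_gt0.
move=> l m al lm mM.
have l0 : 0 < l by lra.
have m0 : 0 < m by lra.
have ml : 0 < m - l by lra.
have lM : l <= M by lra.
have rpos k : 0 < k -> k <= M -> 0 < rho k.
  by move=> k0 kM; apply: rho_gt0 => //; apply: le_lt_trans Mg; rewrite lee_fin.
have rl := rpos _ l0 lM.
have rm := rpos _ m0 mM.
have Qm : Q <= s m / rho m.
  move: mM; rewrite le_eqVlt => /predU1P[->//|mM].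
  exact: (slope_mono m0 mM rm rM).1.
have := psi_sqr_growth l0 lm rl rm.
have := psi_le l0; have := psi_le m0.
have : 0 <= psi C b l by exact: enorm_ge0.
have : 0 <= psi C b m by exact: enorm_ge0.
move: b0 Q0 Qm aQ; rewrite /Q; clear rpos rM rl rm Q bt Mg.
move: (psi C b m) (psi C b l) (enorm b) (s m / rho m) (s M / rho M).
move=> P P' B q Q B0 Q0 Qq aQ P0 P'0 PB P'B growth.
have D0 : 0 < a * Q ^+ 2 * (m - l) by rewrite mulr_gt0.
have growthQ : 2 * (a * Q ^+ 2 * (m - l)) <= P ^+ 2 - P' ^+ 2.
  have Qq2 : Q ^+ 2 <= q ^+ 2 by rewrite ler_pXn2r ?nnegrE//; lra.
  have : a * Q ^+ 2 <= l * q ^+ 2 by apply: ler_pM; rewrite ?sqr_ge0 ?(ltW a0).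
  by move=> /(ler_wpM2r (ltW ml)); lra.
move: D0 growthQ; set D := a * _ * _ => D0 growthQ.
have PP' : 0 <= P - P' by rewrite leNgt; apply/negP => h; nra.
(* This bounds [P ^+ 2 - P' ^+ 2] by [2 * B * (P - P')]. *)
have : 0 <= (P - P') * (2 * B - P - P') by rewrite mulr_ge0//; lra.
by rewrite mulrAC ler_pdivrMr// -/D; lra.
Qed.

End residual.

(** * From a growth rate to the Clarke Jacobian *)

Section one_variable.
Context {R : realType}.

Lemma derive1_ge_growth (f : R -> R) (a b c x : R) : a < x -> x < b ->
  (forall l m, a <= l -> l < m -> m <= b -> c * (m - l) <= f m - f l) ->
  derivable f x 1 -> c <= derive1 f x.
Proof.
move=> ax xb growth df; rewrite /derive1; apply: limr_ge.
  (* [derivable] evaluates [f] at [h *: 1 + x], [derive1] at [h + x]. *)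
  have /cvg_ex[l hl] := df; apply/cvg_ex; exists l.
  move: hl; apply: cvg_trans; apply: near_eq_cvg.
  by near=> h; rewrite /= [h%:A]mulr1.
near=> h.
have h0 : h != 0 by near: h; exact: nbhs_dnbhs_neq.
have hd : `|h| < Num.min (x - a) (b - x).
  near: h; apply: dnbhs0_lt; by rewrite lt_min !subr_gt0 ax.
move: hd; rewrite lt_min !ltr_norml => /andP[/andP[h1 h2] /andP[h3 h4]].
rewrite /= /GRing.scale/= mulrC.
case: (ltgtP h 0) h0 => // hs _.
  (* For negative [h] the growth bound is used from [h + x] to [x]; both signs reverse. *)
  rewrite ler_ndivlMr//.
  have := growth (h + x) x; rewrite opprD => /(_ _ _ _); lra.
rewrite ler_pdivlMr//.
by have := growth x (h + x); lra.
Unshelve. all: by end_near. Qed.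

Lemma clarke_sub (U : set R) (f : R -> R) (x : R) (A : set R) :
  @convex_set R R^o A -> Bsubdiff U f x `<=` A -> clarke U f x `<=` A.
Proof. exact: smallest_sub. Qed.

Lemma convex_set_ge (c : R) : @convex_set R R^o [set v | c <= v].
Proof.
move=> v w t; rewrite !inE/= => hv hw.
change (c <= t%:num * v + (1 - t%:num) * w).
have t0 : 0 <= t%:num by [].
have t1 : t%:num <= 1 by [].
nra.
Qed.

(** The approximating points eventually lie in [(a, b)], where derivatives are at least [c], and
    this bound survives the limit. *)
Lemma Bsubdiff_ge (U : set R) (f : R -> R) (a b c x : R) : a < x -> x < b ->
  (forall l m, a <= l -> l < m -> m <= b -> c * (m - l) <= f m - f l) ->
  Bsubdiff U f x `<=` [set v | c <= v].
Proof.
move=> ax xb growth v [w hw [wx wv]]; apply: cvgr_to_ge wv _.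
near=> k; have [_ dw] := hw k.
apply: derive1_ge_growth growth dw; near: k.
  exact: (cvgr_gt x wx).
exact: (cvgr_lt x wx).
Unshelve. all: by end_near. Qed.

End one_variable.

Theorem theorem7 (R : realType) (p : nat) (b : 'rV[R]_p) (C : set 'rV[R]_p)
  (C_closed : closed C)
  (C_convex : convex_set (C : set (convex_lmodType 'rV[R]_p)))
  (C0 : C 0)
  (gauge_gt0 : (0 < gauge C b)%E)
  (gauge_fin : (gauge C b < +oo)%E)
  (lbar : R) (lbar_gt0 : 0 < lbar) (lbar_lt : (lbar%:E < gauge C b)%E) :
  clarke [set l : R | 0 < l] (psi C b) lbar `<=` [set v : R | 0 < v].
Proof.
(* [M] leaves room to the right of [lbar], so that [[lbar / 2, M]] is a neighbourhood of it. *)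
have [M lM Mg] : exists2 M : R, lbar < M & (M%:E < gauge C b)%E.
  move: gauge_fin lbar_lt; case: (gauge C b) => [g _| |]//.
  rewrite lte_fin => lg; exists ((lbar + g) / 2); rewrite ?lte_fin; lra.
have [c c0 growth] :
    exists2 c : R, 0 < c & forall l m, lbar / 2 <= l -> l < m -> m <= M ->
    c * (m - l) <= psi C b m - psi C b l.
  by apply: psi_growth => //; lra.
have lo : lbar / 2 < lbar by lra.
(* Mere positivity of derivatives could be lost in the limit; the bound [c] is not. *)
apply: (@subset_trans _ [set v | c <= v]); last first.
  by move=> v; exact: lt_le_trans.
apply: clarke_sub; first exact: convex_set_ge.
exact: Bsubdiff_ge lo lM growth.
Qed.
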